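(* Let $W$ be a set of models for a language of formulas closed under the classical propositional connectives. Let $\mathcal{S}$ be a collection of subsets of $W$ (the stereotypes), $D$ a partially ordered set, and $d$ a function assigning to each $F \subseteq W$ and each $S \in \mathcal{S}$ an element $d(F,S) \in D$. Assume: (i) for every $F \subseteq W$ there exists a unique stereotype, denoted $S^{F} \in \mathcal{S}$, such that $d(F,S^{F}) \leq d(F,S)$ for every $S \in \mathcal{S}$; (ii) for all $F, F' \subseteq W$ and all $S, S' \in \mathcal{S}$, if $F' \cap S' \subseteq F \cap S$ and $S - F \subseteq S' - F'$, then $d(F,S) \leq d(F',S')$. Define the relation $\mathrel{|\!\sim}$ on formulas by: $\alpha \mathrel{|\!\sim} \beta$ if and only if every $m \in S^{F_\alpha}$ with $m \models \alpha$ satisfies $m \models \beta$, where $F_\alpha = \{ m \in W : m \models \alpha\}$. Then $\mathrel{|\!\sim}$ satisfies Cut and Cautious Monotonicity, and is therefore cumulative.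
   Context: The satisfaction relation $m \models \alpha$ between elements $m \in W$ and formulas $\alpha$ interprets the propositional connectives classically (in particular $m \models \alpha \wedge \beta$ iff $m \models \alpha$ and $m \models \beta$). Logical consequence and logical equivalence are with respect to $W$: $\alpha$ logically implies $\beta$ if every $m \in W$ satisfying $\alpha$ satisfies $\beta$, and $\alpha$, $\beta$ are logically equivalent if they are satisfied by the same elements of $W$. The notation $S - F$ denotes set difference. For a binary relation $\mathrel{|\!\sim}$ on formulas, consider the following properties (for all formulas $\alpha,\beta,\gamma$): - Reflexivity: $\alpha \mathrel{|\!\sim} \alpha$. - Left Logical Equivalence: if $\alpha$ and $\beta$ are logically equivalent and $\alpha \mathrel{|\!\sim} \gamma$, then $\beta \mathrel{|\!\sim} \gamma$. - Right Weakening: if $\alpha$ logically implies $\beta$ and $\gamma \mathrel{|\!\sim} \alpha$, then $\gamma \mathrel{|\!\sim} \beta$. - Cut: if $\alpha \wedge \beta \mathrel{|\!\sim} \gamma$ and $\alpha \mathrel{|\!\sim} \beta$, then $\alpha \mathrel{|\!\sim} \gamma$. - Cautious Monotonicity: if $\alpha \mathrel{|\!\sim} \beta$ and $\alpha \mathrel{|\!\sim} \gamma$, then $\alpha \wedge \beta \mathrel{|\!\sim} \gamma$. The relation is cumulative if it satisfies all five properties (Kraus–Lehmann–Magidor). *)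

(* Defs.v *)
From mathcomp Require Import all_boot all_order.
From mathcomp Require Import boolp classical_sets.

Set Implicit Arguments.
Unset Strict Implicit.
Unset Printing Implicit Defensive.

Local Open Scope classical_set_scope.

Record language := Language {
  formula :> Type;
  fneg : formula -> formula;
  fand : formula -> formula -> formula;
  for_ : formula -> formula -> formula;
  fimp : formula -> formula -> formula;
  fiff : formula -> formula -> formula }.

Record classical_sat (L : language) (W : Type) (sat : W -> L -> Prop) : Prop :=
  ClassicalSat {
    sat_neg : forall m a, sat m (fneg a) <-> ~ sat m a;
    sat_and : forall m a b, sat m (fand a b) <-> (sat m a /\ sat m b);
    sat_or : forall m a b, sat m (for_ a b) <-> (sat m a \/ sat m b);
    sat_imp : forall m a b, sat m (fimp a b) <-> (sat m a -> sat m b);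
    sat_iff : forall m a b, sat m (fiff a b) <-> (sat m a <-> sat m b) }.

Section Consequence.
Variables (L : language) (W : Type) (sat : W -> L -> Prop).
Implicit Types (a b c : L) (R : L -> L -> Prop).

Definition models_of a : set W := [set m | sat m a].

Definition implies a b := forall m, sat m a -> sat m b.

Definition equivalent a b := forall m, sat m a <-> sat m b.

Definition reflexivity R := forall a, R a a.

Definition left_logical_equivalence R :=
  forall a b c, equivalent a b -> R a c -> R b c.

Definition right_weakening R :=
  forall a b c, implies a b -> R c a -> R c b.

Definition cut R := forall a b c, R (fand a b) c -> R a b -> R a c.

Definition cautious_monotonicity R :=
  forall a b c, R a b -> R a c -> R (fand a b) c.

Definition cumulative R :=
  [/\ reflexivity R, left_logical_equivalence R, right_weakening R,
      cut R & cautious_monotonicity R].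

End Consequence.

Section Stereotypes.
Variables (W : Type) (SS : set (set W)).
Variables (disp : Order.disp_t) (D : porderType disp).
(* The set [SS] is used as a type here: [d F S] exists only for [S] in [SS]. *)
Variable d : set W -> SS -> D.

Definition closest (F : set W) (S : SS) := forall S' : SS, (d F S <= d F S')%O.

Definition has_unique_closest := forall F : set W, exists! S : SS, closest F S.

Definition stereotype (uniq_closest : has_unique_closest) (F : set W) : SS :=
  sval (cid (uniq_closest F)).

Definition distance_monotone :=
  forall (F F' : set W) (S S' : SS),
    F' `&` \val S' `<=` F `&` \val S ->
    \val S `\` F `<=` \val S' `\` F' ->
    (d F S <= d F' S')%O.

Definition stereotypical_entails (L : language) (sat : W -> L -> Prop)
    (uniq_closest : has_unique_closest) (a b : L) :=
  forall m : W,
    (\val (stereotype uniq_closest (models_of sat a)) : set W) m ->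
    sat m a -> sat m b.

End Stereotypes.

(* Main.v *)
(** Passing from [F] to a subset [F'] which still contains the part of [S^F]
    lying in [F] changes neither [S^F `&` F] nor [S^F `\` F], while it can only
    increase the distance to any other stereotype. Hence [S^F] remains closest,
    so the two stereotypes coincide. With [F] the models of [a] and [F'] those
    of [a /\ b], this yields Cut and Cautious Monotonicity at once. *)
Require Import Defs.
From mathcomp Require Import all_boot all_order.
From mathcomp Require Import boolp classical_sets.

Import Order.TTheory.

Local Open Scope classical_set_scope.

Section StereotypeStability.
Context {W : Type} {SS : set (set W)} {disp : Order.disp_t}.
Context {D : porderType disp} {d : set W -> SS -> D}.
Hypothesis (Hi : has_unique_closest d).

Lemma stereotype_closest (F : set W) : closest d F (stereotype Hi F).
Proof. by rewrite /stereotype; case: cid => S []. Qed.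

Lemma closest_stereotype (F : set W) (S : SS) :
  closest d F S -> stereotype Hi F = S.
Proof. by rewrite /stereotype; case: cid => T /= [_]; apply. Qed.

Hypothesis (Hii : distance_monotone d).

Lemma stereotype_subset (F F' : set W) :
  F' `<=` F -> \val (stereotype Hi F) `&` F `<=` F' ->
  stereotype Hi F' = stereotype Hi F.
Proof.
move=> F'F SFF'; apply: closest_stereotype => T.
(* With [S] the stereotype of [F], the chain is [d F' S <= d F S <= d F T <= d F' T]: the outer
   steps use [Hii], the middle one that [S] is closest to [F]. *)
apply: (@le_trans _ _ (d F (stereotype Hi F))).
  apply: Hii => m [].
    by move=> Fm Sm; split=> //; apply: SFF'.
  by move=> Sm nF'm; split=> // Fm; apply: nF'm; apply: SFF'.
apply: le_trans (stereotype_closest F T) _.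
apply: Hii => m [].
  by move=> F'm Tm; split=> //; apply: F'F.
by move=> Tm nFm; split=> // F'm; apply: nFm; apply: F'F.
Qed.

Context {L : language} {sat : W -> L -> Prop}.
Hypothesis (Hsat : classical_sat sat).

(** Entailment of [b] by [a] says precisely that the models of [a] inside its stereotype are models
    of [fand a b]. *)
Lemma stereotype_fand (a b : L) :
  stereotypical_entails sat Hi a b ->
  stereotype Hi (models_of sat (fand a b)) = stereotype Hi (models_of sat a).
Proof.
move=> ab; apply: stereotype_subset => m.
  by move=> /(sat_and Hsat)[].
by move=> [Sm am]; apply/(sat_and Hsat); split=> //; apply: ab.
Qed.

Lemma stereotypical_cut : cut (stereotypical_entails sat Hi).
Proof.
move=> a b c abc ab m Sm am; apply: abc; first by rewrite stereotype_fand.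
by apply/(sat_and Hsat); split=> //; apply: ab.
Qed.

Lemma stereotypical_cautious_monotonicity :
  cautious_monotonicity (stereotypical_entails sat Hi).
Proof.
(* Here [ab] serves to identify the two stereotypes; then [ac] applies. *)
move=> a b c ab ac m; rewrite stereotype_fand // => Sm /(sat_and Hsat)[am _].
exact: ac.
Qed.

Lemma stereotypical_left_logical_equivalence :
  left_logical_equivalence sat (stereotypical_entails sat Hi).
Proof.
move=> a b c eq_ab ac m.
(* By set extensionality, both formulas get the same stereotype. *)
have <- : models_of sat a = models_of sat b by apply/seteqP; split=> x /eq_ab.
by move=> Sm /eq_ab; apply: ac.
Qed.

End StereotypeStability.

Theorem corollary1 (L : language) (W : Type) (sat : W -> L -> Prop)
    (Hsat : classical_sat sat)
    (SS : set (set W)) (disp : Order.disp_t) (D : porderType disp)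
    (d : set W -> SS -> D)
    (Hi : has_unique_closest d) (Hii : distance_monotone d) :
  cut (stereotypical_entails sat Hi) /\
  cautious_monotonicity (stereotypical_entails sat Hi) /\
  cumulative sat (stereotypical_entails sat Hi).
Proof.
have Hcut := stereotypical_cut Hi Hii Hsat.
have Hcm := stereotypical_cautious_monotonicity Hi Hii Hsat.
split=> //; split=> //; split=> //.
- by move=> a m.
- exact: stereotypical_left_logical_equivalence.
- by move=> a b c ab ca m Sm cm; apply: ab; apply: ca.
Qed.
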